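(* Let $\mu$ be a balanced measure on $\mathbb{R}$ and let $N\ge0$ be an integer. The maximal operator $$\mathcal{M}^Nf(x)=\sup_{\substack{I,J\in\mathscr{D}:\\ \operatorname{dist}_{\mathscr{D}}(I,J)\le N+2}}c_1^b(I,J)\,\langle|f|\rangle_I\,1_J(x)$$ is bounded on $L^p(\mu)$ for every $1<p\le\infty$ and is of weak type $(1,1)$, i.e. bounded from $L^1(\mu)$ to $L^{1,\infty}(\mu)$.
   Context: $\mathscr{D}$ is the standard dyadic system of half-open intervals $2^{-k}[j,j+1)$, $j,k\in\mathbb{Z}$. For $I\in\mathscr{D}$, $I_-$ and $I_+$ are its left and right dyadic children, $\widehat{I}$ its dyadic parent, and $I^{(j)}$ its $j$-th dyadic ancestor ($I^{(0)}=I$). The dyadic distance is $\operatorname{dist}_{\mathscr{D}}(I,J)=\min\{s+t:\ s,t\ge0,\ I^{(s)}=J^{(t)}\}$, and $=\infty$ if $I,J$ have no common dyadic ancestor. $\mu$ is a Borel measure on $\mathbb{R}$ with $0<\mu(I)<\infty$ for all $I\in\mathscr{D}$; $\langle f\rangle_I=\mu(I)^{-1}\int_I f\,d\mu$ and $m(I)=\mu(I_-)\mu(I_+)/\mu(I)$. The measure $\mu$ is balanced if it has no atoms and there is $c\ge1$ with $c^{-1}m(\widehat{I})\le m(I)\le c\,m(\widehat{I})$ for all $I\in\mathscr{D}$. For $I,J\in\mathscr{D}$: $c_1^b(I,J)=1$ if $I=J$, and $c_1^b(I,J)=\frac{\sqrt{m(I)m(J)}}{\mu(J)}$ otherwise.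 *)

(* Defs.v *)
From mathcomp Require Import all_boot all_order all_algebra.
From mathcomp Require Import all_classical all_reals all_analysis.
From mathcomp Require Import measurable_realfun ess_sup_inf zify lra.
Set Implicit Arguments.
Unset Strict Implicit.
Unset Printing Implicit Defensive.
Import Order.TTheory GRing.Theory Num.Theory.
Local Open Scope classical_set_scope.
Local Open Scope ring_scope.

(* The dyadic interval 2^-k [j, j+1) is represented by the pair (k, j); by
   [ditv_inj] below, equality of indices is equality of intervals. *)
Notation dyadic := (int * int)%type.

Definition ditv {R : realType} (I : dyadic) : set R :=
  `[(2 : R) ^ (- I.1) * I.2%:~R, (2 : R) ^ (- I.1) * (I.2 + 1)%:~R[%classic.

Definition dleft (I : dyadic) : dyadic := (I.1 + 1, 2 * I.2).
Definition dright (I : dyadic) : dyadic := (I.1 + 1, 2 * I.2 + 1).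
(* The divisor 2 is positive, so (_ %/ 2)%Z is the floor of the quotient. *)
Definition dparent (I : dyadic) : dyadic := (I.1 - 1, (I.2 %/ 2)%Z).
Definition dancestor (s : nat) (I : dyadic) : dyadic := iter s dparent I.

(* The infimum over the empty set is +oo. *)
Definition ddist {R : realType} (I J : dyadic) : \bar R :=
  ereal_inf [set d | exists s t : nat,
    dancestor s I = dancestor t J /\ d = ((s + t)%N%:R : R)%:E].

Lemma ditvE {R : realType} (I : dyadic) (x : R) :
  ditv I x <-> (I.2%:~R <= x * 2 ^ I.1 < (I.2 + 1)%:~R).
Proof.
have p : 0 < (2 : R) ^ I.1 by rewrite exprz_gt0.
rewrite /ditv /= in_itv /= -invr_expz ![_^-1 * _]mulrC.
by rewrite ler_pdivrMr // ltr_pdivlMr.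
Qed.

Lemma ditv_children {R : realType} (I : dyadic) :
  @ditv R I = ditv (dleft I) `|` ditv (dright I).
Proof.
apply/seteqP; split => x.
  move=> /ditvE/andP[h1 h2].
  have [h|h] := ltP (x * 2 ^ I.1 * 2) (2 * I.2 + 1)%:~R; [left|right];
    apply/ditvE; rewrite /= expfzDr ?pnatr_eq0// expr1z mulrA;
    move: h1 h2 h; rewrite !(intrD, intrM) => h1 h2 h;
    apply/andP; split; lra.
by move=> [] /ditvE/andP[]; rewrite /= expfzDr ?pnatr_eq0// expr1z mulrA;
  rewrite !(intrD, intrM) => h1 h2; apply/ditvE/andP;
  rewrite !(intrD, intrM); split; lra.
Qed.

Lemma dparent_left (I : dyadic) : dparent (dleft I) = I.
Proof.
by case: I => k j; rewrite /dparent /dleft /= addrK mulKz.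
Qed.

Lemma dparent_right (I : dyadic) : dparent (dright I) = I.
Proof.
by case: I => k j; rewrite /dparent /dright /= addrK mulrC divzMDl // addr0.
Qed.

Lemma dparentE (I J : dyadic) :
  (I = dparent J) <-> (J = dleft I \/ J = dright I).
Proof.
split=> [->|[]->]; last 2 first.
- by rewrite dparent_left.
- by rewrite dparent_right.
case: J => k j; rewrite /dparent /dleft /dright /= subrK mulrC.
have := divz_eq j 2; have := modz_ge0 j (isT : (2 : int) != 0).
have := ltz_pmod j (isT : (0 < 2 :> int)).
set r := (j %% 2)%Z => h1 h2 e.
have [e0|e1] : r = 0 \/ r = 1 by lia.
  by left; congr pair; rewrite {1}e e0 addr0.
by right; congr pair; rewrite {1}e e1.
Qed.

Lemma ditv_inj {R : realType} : injective (@ditv R).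
Proof.
move=> [k j] [l i] e.
have p (n : int) : 0 < (2 : R) ^ n by rewrite exprz_gt0.
set a := (2 : R) ^ (- k) * j%:~R; set b := (2 : R) ^ (- k) * (j + 1)%:~R.
set c := (2 : R) ^ (- l) * i%:~R; set d := (2 : R) ^ (- l) * (i + 1)%:~R.
have ab : a < b by rewrite ltr_pM2l // ltr_int; lia.
have cd : c < d by rewrite ltr_pM2l // ltr_int; lia.
have E x : (a <= x < b) = (c <= x < d).
  have /(congr1 (fun A => A x)) := e; rewrite /ditv /= !in_itv /= => {}e.
  by apply/idP/idP; rewrite e.
have ac : a = c.
  by have := E a; have := E c; rewrite !lexx ab cd /= => h1 h2;
    apply/eqP; rewrite eq_le; move: h1 => /andP[-> _]; case/andP: (esym h2).
have bd : b = d.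
  case: (ltgtP b d) => // h.
    by have := E b; rewrite ltxx andbF h -ac (ltW ab).
  by have := E d; rewrite ltxx andbF h ac (ltW cd).
have kl : (2 : R) ^ (- k) = (2 : R) ^ (- l).
  have -> : (2 : R) ^ (- k) = b - a by rewrite /a /b intrD mulrDr mulr1 addrC addKr.
  by rewrite bd ac /c /d intrD mulrDr mulr1 addrC addKr.
have kl' : k = l.
  by apply: oppr_inj; apply: (ieexprIz _ _ kl); rewrite ?ltr0n ?pnatr_eq1.
rewrite kl'; congr pair.
move: ac; rewrite /a /c kl; move/(mulfI (lt0r_neq0 (p _))).
exact: intr_inj.
Qed.

Section bounded_operators.
Context d (T : measurableType d) (R : realType) (mu : {measure set T -> \bar R}).
Implicit Type M : (T -> R) -> T -> \bar R.

Definition is_atom (A : set T) : Prop :=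
  [/\ measurable A, (0 < mu A)%E &
      forall B, measurable B -> B `<=` A -> (mu B < mu A)%E -> mu B = 0%E].

(* The quasinorm of L^{1,oo}(mu). *)
Definition weakL1norm (g : T -> \bar R) : \bar R :=
  ereal_sup [set (t%:E * mu [set x | t%:E < `|g x|])%E | t in [set t : R | 0 < t]].

(* Measurability of the image is part of belonging to the target space. *)
Definition bounded_Lp (p : \bar R) M : Prop :=
  exists2 C : R, 0 <= C & forall f : T -> R, f \in Lfun mu p ->
    measurable_fun [set: T] (M f) /\
    ('N[mu]_p [M f] <= C%:E * 'N[mu]_p [EFin \o f])%E.

Definition weak_type11 M : Prop :=
  exists2 C : R, 0 <= C & forall f : T -> R, f \in Lfun mu 1 ->
    measurable_fun [set: T] (M f) /\
    (weakL1norm (M f) <= C%:E * 'N[mu]_1 [EFin \o f])%E.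

End bounded_operators.

Section balanced_measures.
Context {R : realType} (mu : {measure set (measurableTypeR R) -> \bar R}).

Definition dmass (I : dyadic) : R := fine (mu (ditv I)).

Definition dm (I : dyadic) : R :=
  dmass (dleft I) * dmass (dright I) / dmass I.

(* The first clause is the standing assumption 0 < mu I < +oo, under which
   [dmass] does not truncate. *)
Definition balanced : Prop :=
  [/\ forall I : dyadic, (0 < mu (ditv I) < +oo)%E,
      forall A, ~ is_atom mu A &
      exists2 c : R, 1 <= c & forall I : dyadic,
        c^-1 * dm (dparent I) <= dm I <= c * dm (dparent I)].

Definition c1b (I J : dyadic) : R :=
  if I == J then 1 else Num.sqrt (dm I * dm J) / dmass J.

Definition daverage (f : R -> \bar R) (I : dyadic) : \bar R :=
  ((dmass I)^-1%:E * \int[mu]_(y in ditv I) f y)%E.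

Definition dmaximal (N : nat) (f : R -> R) (x : R) : \bar R :=
  ereal_sup [set v | exists I J : dyadic,
    (@ddist R I J <= (N + 2)%N%:R%:E)%E /\
    v = ((c1b I J)%:E * daverage (fun y => `|f y|%:E) I
          * (\1_(ditv J) x)%:E)%E].

End balanced_measures.

(* Main.v *)
Require Import Defs.
From mathcomp Require Import all_boot all_order all_algebra.
From mathcomp Require Import all_classical all_reals all_analysis.
From mathcomp Require Import measurable_realfun ess_sup_inf.
From mathcomp Require Import zify lra.
Import Order.TTheory GRing.Theory Num.Theory.
Local Open Scope classical_set_scope.
Local Open Scope ring_scope.

(** Balancedness gives, for dist(I, J) <= N + 2, both c_1^b(I, J) <= D and
    c_1^b(I, J) mu(J) <= D mu(I). Let Om be the union of the intervals on which
    the average of |f| is at least lam / D; the dyadic maximal theorem bounds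
    mu(Om). If (I, J) contributes to {M^N f > lam}, then I lies in Om and
    mu(J) <= (D / lam) int_I |f|. If moreover J is not inside Om, then neither
    is the common ancestor I^(s), s <= N + 2; among such I, two nested ones whose
    generations agree modulo N + 3 coincide (otherwise the larger would contain
    I^(s)), so the integrals over I add up to at most (N + 3) int |f|, and each I
    has boundedly many J. This is the weak (1,1) bound. The L^oo bound is
    c_1^b <= D, and 1 < p < oo follows by Marcinkiewicz interpolation: f is
    truncated at height lam / (2 D) and the levels lam = 2^k are summed. *)

(** * Measures of countable and finite unions *)

Section countable_cover.
Context {d} {T : measurableType d} {R : realType} (mu : {measure set T -> \bar R}).

Lemma measurable_bigcup_countType {C : countType} (P : set C) (F : C -> set T) :
  (forall i, measurable (F i)) -> measurable (\bigcup_(i in P) F i).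
Proof.
move=> mF; rewrite bigcup_mkcond; apply: countable_bigcupT_measurable => //.
by move=> i; case: ifP.
Qed.

(** The [B i] may overlap, so subadditivity is used for them; disjointness of the [A i] then turns
    the sum of integrals into a single integral. With [A i] the interval averaged over and [B i] the
    interval reached, it serves both weak-type estimates. *)
Lemma measure_bigcup_le_integral {C : countType} (P : set C) (A B : C -> set T)
    (f : T -> \bar R) (b : R) :
  (forall i, measurable (A i)) -> (forall i, measurable (B i)) ->
  trivIset P A -> measurable_fun [set: T] f -> (forall x, 0 <= f x)%E ->
  0 <= b ->
  (forall i, P i -> mu (B i) <= b%:E * \int[mu]_(x in A i) f x)%E ->
  (mu (\bigcup_(i in P) B i) <= b%:E * \int[mu]_x f x)%E.
Proof.
(* Families over [C] become sequences along [pickle], with the empty set at every number that is not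
   the code of a member of [P]. *)
move=> mA mB tA mf f0 b0 muB.
pose sel (F : C -> set T) (n : nat) : set T :=
  if pickle_inv n is Some i then (if i \in P then F i else set0) else set0.
have msel F n : (forall i, measurable (F i)) -> measurable (sel F n).
  by move=> mF; rewrite /sel; case: pickle_inv => // i; case: ifP.
have tsel : trivIset [set: nat] (sel A).
  move=> m n _ _; rewrite /sel.
  have := @pickle_invK C m; have := @pickle_invK C n.
  case: pickle_inv => [j|] /=; last by move=> _ _ []x[].
  case: pickle_inv => [i|] /=; last by move=> _ _ []x[].
  move=> <- <-; case: ifPn => [|_]; last by move=> []x[].
  case: ifPn => [|_]; last by move=> _ []x[].
  by rewrite !inE => Pj Pi /(tA _ _ Pi Pj) ->.
have sub : \bigcup_(i in P) B i `<=` \bigcup_n sel B n.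
  move=> x [i Pi Bix]; exists (pickle i) => //.
  by rewrite /sel pickleK_inv mem_set.
have mP := measurable_bigcup_countType P _ mB.
have mselB n : measurable (sel B n) by exact: msel.
apply: (le_trans (measure_sigma_subadditive mu mselB mP sub)).
apply: (@le_trans _ _ (\sum_(n <oo) b%:E * \int[mu]_(x in sel A n) f x)%E).
  apply: lee_nneseries => // n _; rewrite /sel.
  case: pickle_inv => [i|]; last by rewrite measure0 integral_set0 mule0.
  case: ifPn => [|_]; last by rewrite measure0 integral_set0 mule0.
  by rewrite inE; exact: muB.
rewrite nneseriesZl//; last by move=> n _; exact: integral_ge0.
rewrite lee_wpmul2l ?lee_fin// -ge0_integral_bigcup//; last first.
- exact: measurable_funTS.
- by move=> n; exact: msel.
apply: ge0_subset_integral => //.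
by apply: bigcup_measurable => n _; exact: msel.
Qed.

Lemma measure_bigcup_finType_le (F : finType) (A : F -> set T)
    (b : R) (X : \bar R) :
  (forall i, measurable (A i)) -> (forall i, mu (A i) <= b%:E * X)%E ->
  0 <= b -> (mu (\bigcup_i A i) <= (#|F|%:R * b)%:E * X)%E.
Proof.
move=> mA hA b0.
have mU : measurable (\bigcup_i A i) by exact: measurable_bigcup_countType.
have fT : finite_set [set: F] by exact: finite_finset.
apply: (le_trans (content_sub_fsum mu fT (fun i _ => mA i) mU _)) => //.
rewrite (fsbigE (enum F)) ?enum_uniq//=; last first.
  by move=> i _; rewrite mem_enum.
rewrite (eq_bigl xpredT) => [|i]; last by rewrite in_setT.
rewrite big_enum (le_trans (lee_sum _ (fun i _ => hA i)))//=.
rewrite -ge0_sume_distrl; last by move=> i _; rewrite lee_fin.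
by rewrite sumEFin sumr_const mulr_natl.
Qed.

End countable_cover.

(** * Discretisation of powers over the levels 2^k *)

Section dyadic_levels.
Context {R : realType}.
Implicit Types (k : int) (p q u r : R).

Definition level_pow q k u : R := ((2 : R) ^ k) `^ q * ((2 : R) ^ k < u)%R%:R.

Lemma level_pow_ge0 q k u : 0 <= level_pow q k u.
Proof. by rewrite mulr_ge0 ?powR_ge0. Qed.

(* The summands telescope against [min (2 ^ (k - 1)) u `^ q]. *)
Lemma sum_level_pow_le q u (n : nat) : 0 < q -> 0 <= u ->
  \sum_(i < n) (level_pow q i%:Z u + level_pow q (- (i.+1)%:Z) u) <=
  (1 - ((2 : R) `^ q)^-1)^-1 * u `^ q.
Proof.
move=> q0 u0; set C := (1 - _)^-1.
have two0 k : 0 < (2 : R) ^ k by rewrite exprz_gt0.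
have c1 : 1 < (2 : R) `^ q.
  have := @gt0_ltr_powR R q q0 1 2; rewrite powR1.
  by apply; rewrite ?nnegrE ?ltr1n.
have c0 : 0 < (2 : R) `^ q by exact: lt_trans c1.
have C0 : 0 < C by rewrite invr_gt0 subr_gt0 invf_lt1.
pose G k := (Num.min ((2 : R) ^ (k - 1)) u) `^ q.
have Gu k : G k <= u `^ q.
  by apply: ge0_ler_powR; rewrite ?nnegrE ?(ltW q0)// ?le_min ?ge_min ?lexx
    ?orbT// ltW.
have GS k : G k <= G (k + 1).
  apply: ge0_ler_powR; rewrite ?nnegrE ?(ltW q0)// ?le_min ?u0 ?(ltW (two0 _))//.
  rewrite !ge_min lexx orbT andbT; apply/orP; left.
  by rewrite ler_weXz2l ?ler1n//; lia.
(* If 2^k < u, the difference of [G] is 2^(kq) (1 - 2^(-q)), which [C] normalises; otherwise the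
   left side is 0 and [G] is monotone. *)
have step k : level_pow q k u <= C * (G (k + 1) - G k).
  rewrite /level_pow; case: ltP => [ku|_]; last first.
    by rewrite mulr0 mulr_ge0 ?subr_ge0// ltW.
  have km : (2 : R) ^ (k - 1) <= (2 : R) ^ k by rewrite ler_weXz2l ?ler1n//; lia.
  rewrite mulr1 /G addrK !min_l ?(ltW ku)//; last first.
    by rewrite ltW// (le_lt_trans km).
  rewrite expfzDr ?pnatr_eq0// powRM ?(ltW (two0 _))//.
  have -> : ((2 : R) ^ (-1)) `^ q = ((2 : R) `^ q)^-1.
    by rewrite -powR_intmul// -powRrM mulrC powRrM powR_inv1 ?powR_ge0.
  rewrite -[X in X - _]mulr1 -mulrBr mulrCA mulVf ?mulr1//.
  by rewrite gt_eqF// subr_gt0 invf_lt1.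
suff : \sum_(i < n) (level_pow q i%:Z u + level_pow q (- (i.+1)%:Z) u) <=
    C * (G n%:Z - G (- n%:Z)).
  move=> /le_trans; apply; rewrite ler_pM2l// (le_trans _ (Gu n%:Z))//.
  by rewrite lerBlDr lerDl powR_ge0.
elim: n => [|n IHn]; first by rewrite big_ord0 subrr mulr0.
rewrite big_ord_recr /= (le_trans (lerD IHn (lerD (step _) (step _))))//.
rewrite -!mulrDr ler_pM2l//.
have -> : n%:Z + 1 = n.+1%:Z by lia.
have -> : - n.+1%:Z + 1 = - n%:Z by lia.
lra.
Qed.

(** The exponent is the ceiling of log_2 r minus 1; the ceiling makes the left inequality strict, as
    the strict level sets require. *)
Lemma exists_dyadic_scale r : 0 < r ->
  exists k : int, (2 : R) ^ k < r /\ r <= (2 : R) * (2 : R) ^ k.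
Proof.
move=> r0; pose l := ln r / ln 2.
have ln2 : 0 < ln (2 : R) by rewrite ln_gt0// ltr1n.
have rE : r = (2 : R) `^ l.
  by rewrite /powR pnatr_eq0 /= divfK ?gt_eqF// lnK// posrE.
have two1 : (1 : R) < 2 by rewrite ltr1n.
exists (Num.ceil l - 1); rewrite -[in X in _ <= X](expr1z (2 : R)) -expfzDr ?pnatr_eq0//.
have -> : 1 + (Num.ceil l - 1) = Num.ceil l by lia.
rewrite -!powR_intmul// {1 2}rE; split.
  by rewrite /powR pnatr_eq0 /= ltr_expR ltr_pM2r// ceilB1_lt.
by apply: ler_powR; [exact: ltW|exact: ceil_ge].
Qed.

(** The analogue of [level_pow] for a function that may take the value +oo. *)
Definition elevel_pow p k (y : \bar R) : \bar R :=
  (((2 : R) ^ k) `^ p * (((2 : R) ^ k)%:E < y)%E%:R)%:E.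

Lemma elevel_pow_ge0 p k y : (0 <= elevel_pow p k y)%E.
Proof. by rewrite lee_fin mulr_ge0 ?powR_ge0. Qed.

(* The pairs [i], [- (i + 1)] enumerate the integers. *)
Definition level_series p (y : \bar R) : \bar R :=
  (\sum_(i <oo) (elevel_pow p i%:Z y + elevel_pow p (- i.+1%:Z) y))%E.

Lemma level_series_ge p k (y : \bar R) : (((2 : R) ^ k)%:E < y)%E ->
  ((((2 : R) ^ k) `^ p)%:E <= level_series p y)%E.
Proof.
(* [m] is the position of the pair containing [k]: first entry if k >= 0, second entry if k < 0. *)
move=> ky; pose m := if 0 <= k then absz k else (absz k).-1.
have -> : (((2 : R) ^ k) `^ p)%:E = elevel_pow p k y.
  by rewrite /elevel_pow ky mulr1.
apply: le_trans (nneseries_lim_ge m.+1 _); last first.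
  by move=> n _ _; rewrite adde_ge0 ?elevel_pow_ge0.
rewrite big_nat_recr//=; apply: le_trans (leeDr _ _); last first.
  by apply: sume_ge0 => i _; rewrite adde_ge0 ?elevel_pow_ge0.
rewrite /m; case: (leP 0 k) => k0.
  by rewrite (gez0_abs k0) leeDl// elevel_pow_ge0.
have -> : (absz k).-1.+1 = absz k by lia.
by rewrite (ltz0_abs k0) opprK leeDr// elevel_pow_ge0.
Qed.

(** A single term suffices: the largest 2^k strictly below [r] satisfies r <= 2 * 2^k, which costs
    the factor 2^p. *)
Lemma poweR_le_level_series p (y : \bar R) : 0 < p -> (0 <= y)%E ->
  (y `^ p <= ((2 : R) `^ p)%:E * level_series p y)%E.
Proof.
move=> p0 y0.
have key r : 0 < r -> (r%:E <= y)%E ->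
    ((r `^ p)%:E <= ((2 : R) `^ p)%:E * level_series p y)%E.
  move=> r0 ry; have [k [kr rk]] := exists_dyadic_scale _ r0.
  apply: (@le_trans _ _ ((2 : R) `^ p * ((2 : R) ^ k) `^ p)%:E).
    have k0 : 0 <= (2 : R) ^ k by rewrite ltW// exprz_gt0.
    rewrite lee_fin -powRM//.
    by apply: ge0_ler_powR; rewrite ?nnegrE ?(ltW p0) ?(ltW r0)// mulr_ge0.
  rewrite EFinM lee_wpmul2l ?lee_fin ?powR_ge0//.
  by apply: level_series_ge; apply: lt_le_trans ry; rewrite lte_fin.
case: y y0 key => [r| |]//= r0 key.
  rewrite lee_fin le_eqVlt in r0; case/predU1P: r0 => [<-|r0].
    rewrite powR0 ?gt_eqF// mule_ge0 ?lee_fin ?powR_ge0//.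
    by apply: nneseries_ge0 => n _ _; rewrite adde_ge0 ?elevel_pow_ge0.
  exact: key.
(* At y = +oo the bound [key] holds for every positive [r]; taking r = t^(1/p) shows that the right
   side exceeds any [t]. *)
rewrite gt_eqF// [X in (_ <= X)%E](_ : _ = +oo%E)//; apply: eq_infty => t.
have [t0|t0] := leP t 0.
  apply: le_trans (key 1 ltr01 (leey _)).
  by rewrite powR1 lee_fin (le_trans t0).
have := key (t `^ p^-1) (powR_gt0 _ t0) (leey _).
by rewrite -powRrM mulVf ?gt_eqF// powRr1// ltW.
Qed.

End dyadic_levels.

(** * Marcinkiewicz interpolation from a truncated weak-type bound *)

Section interpolation.
Context {d} {T : measurableType d} {R : realType} (mu : {measure set T -> \bar R}).

(** Weighting the hypothesis at lam = 2^k by 2^(kp) and summing over [k] leaves, under the integral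
    of |f|, the sum of 2^(k(p-1)) over 2^k < D |f|. This sum is geometric because p > 1, and it is
    at most a constant times (D |f|)^(p-1). *)
Lemma marcinkiewicz_level_bound (p A D : R) : 1 < p -> 0 <= A -> 0 < D ->
  exists2 C : R, 0 <= C & forall (f : T -> R) (g : T -> \bar R),
  measurable_fun [set: T] f -> measurable_fun [set: T] g ->
  (forall x, 0 <= g x)%E ->
  (forall lam : R, 0 < lam -> (mu [set x | (lam%:E < g x)%E] <=
     (A / lam)%:E * \int[mu]_x (`|f x| * (lam < D * `|f x|)%R%:R)%:E)%E) ->
  (\int[mu]_x (g x `^ p) <= C%:E * \int[mu]_x (`|f x| `^ p)%:E)%E.
Proof.
move=> p1 A0 D0; have q0 : 0 < p - 1 by rewrite subr_gt0.
have p0 : 0 < p by exact: lt_trans p1.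
set q := p - 1 in q0 *.
have B0 : 0 <= (1 - ((2 : R) `^ q)^-1)^-1.
  rewrite invr_ge0 subr_ge0 invf_le1 ?powR_gt0//.
  by rewrite -[leLHS](powRr0 2) ler_powR ?ler1n// ltW.
set B := (1 - _)^-1 in B0.
(* The factor 2^p comes from replacing g^p by its level series, [A] from the weak bound, and B D^q
   from the geometric sum at u = D |f|. *)
exists ((2 : R) `^ p * (A * (B * D `^ q))).
  by rewrite !mulr_ge0 ?powR_ge0.
move=> f g mf mg g0 weak.
have two0 k : 0 < (2 : R) ^ k by rewrite exprz_gt0.
have mnf : measurable_fun [set: T] (fun x => `|f x|) by exact: measurableT_comp.
have mbool (h : T -> bool) : measurable [set x | h x] ->
    measurable_fun [set: T] (fun x => (h x)%:R : R).
  move=> mh; rewrite (_ : (fun x => _) = \1_[set x | h x]).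
    exact: measurable_indic.
  by apply/funext => x; rewrite indicE; congr (nat_of_bool _)%:R;
    apply/idP/idP; rewrite inE.
have mlevel k : measurable_fun [set: T] (fun x => level_pow q k (D * `|f x|)).
  apply: measurable_funM => //; apply: mbool.
  rewrite -[X in measurable X]setTI; apply: measurable_fun_ltr => //.
  exact: measurable_funM.
have mgt (r : R) : measurable [set x | (r%:E < g x)%E].
  by rewrite -[X in measurable X]setTI; exact: emeasurable_fun_o_infty.
have melevel k : measurable_fun [set: T] (fun x => elevel_pow p k (g x)).
  suff : measurable_fun [set: T]
      (fun x => ((2 : R) ^ k) `^ p * (((2 : R) ^ k)%:E < g x)%E%:R).
    by move=> /measurable_EFinP.
  by apply: measurable_funM => //; exact: mbool.
(* The denominator lam = 2^k of the weak bound lowers the exponent from [p] to q = p - 1. *)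
have int_level k : (\int[mu]_x elevel_pow p k (g x) <=
    A%:E * \int[mu]_x (`|f x| * level_pow q k (D * `|f x|))%:E)%E.
  have k0 := two0 k.
  have -> : (\int[mu]_x elevel_pow p k (g x) =
      (((2 : R) ^ k) `^ p)%:E * mu [set x | (((2 : R) ^ k)%:E < g x)%E])%E.
    rewrite -[X in mu X]setIT -integral_indic//.
    rewrite -ge0_integralZl//; last 2 first.
    - by apply/measurable_EFinP; exact: measurable_indic.
    - by rewrite lee_fin powR_ge0.
    apply: eq_integral => x _; rewrite -EFinM indicE /elevel_pow.
    by congr (_ * (nat_of_bool _)%:R)%:E; apply/idP/idP; rewrite inE.
  apply: (le_trans (lee_wpmul2l _ (weak _ k0))).
    by rewrite lee_fin powR_ge0.
  rewrite muleA -EFinM.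
  have -> : ((2 : R) ^ k) `^ p * (A / (2 : R) ^ k) = A * ((2 : R) ^ k) `^ q.
    rewrite /q powRB; last by rewrite (gt_eqF k0) implybT.
    by rewrite powRr1 ?(ltW k0)// mulrCA.
  rewrite EFinM -muleA lee_wpmul2l ?lee_fin//.
  rewrite -ge0_integralZl//; last 2 first.
  - apply/measurable_EFinP; apply: measurable_funM => //; apply: mbool.
    rewrite -[X in measurable X]setTI; apply: measurable_fun_ltr => //.
    exact: measurable_funM.
  - by rewrite lee_fin powR_ge0.
  by under eq_integral do rewrite -EFinM mulrCA.
pose h i x := (elevel_pow p i%:Z (g x) + elevel_pow p (- i.+1%:Z) (g x))%E.
have mh i : measurable_fun [set: T] (h i) by exact: emeasurable_funD.
have h0 i x : (0 <= h i x)%E by rewrite adde_ge0 ?elevel_pow_ge0.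
have mseries : measurable_fun [set: T] (fun x => level_series p (g x)).
  apply: ge0_emeasurable_sum => [i x _ _|i _]; last exact: mh.
  exact: h0.
have series0 x : (0 <= level_series p (g x))%E.
  by apply: nneseries_ge0 => i _ _; exact: h0.
apply: (@le_trans _ _ (\int[mu]_x (((2 : R) `^ p)%:E * level_series p (g x)))%E).
  apply: ge0_le_integral => //.
  - by move=> x _; exact: poweR_ge0.
  - exact: (measurableT_comp (measurable_poweR _)).
  - exact: measurable_funeM.
  - by move=> x _; exact: poweR_le_level_series.
rewrite ge0_integralZl//.
rewrite [in leRHS]EFinM -muleA lee_wpmul2l ?lee_fin ?powR_ge0//.
rewrite /level_series integral_nneseries//; last by move=> n x _; exact: h0.
(* It is enough to bound the partial sums uniformly in [n]. *)
apply: lime_le.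
  apply: is_cvg_nneseries => n _ _; apply: integral_ge0 => x _; exact: h0.
apply: nearW => n.
pose l i x := level_pow q i%:Z (D * `|f x|) + level_pow q (- i.+1%:Z) (D * `|f x|).
have l0 i x : 0 <= l i x by rewrite addr_ge0 ?level_pow_ge0.
have ml i : measurable_fun [set: T] (l i) by exact: measurable_funD.
have int_h i : (\int[mu]_x h i x <= A%:E * \int[mu]_x (`|f x| * l i x)%:E)%E.
  rewrite ge0_integralD//; try by move=> x _; exact: elevel_pow_ge0.
  apply: (le_trans (leeD (int_level _) (int_level _))).
  rewrite -ge0_muleDr; try by apply: integral_ge0 => x _;
    rewrite lee_fin mulr_ge0 ?level_pow_ge0.
  rewrite -ge0_integralD//; try by [move=> x _; rewrite lee_fin mulr_ge0 ?level_pow_ge0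
    | apply/measurable_EFinP; exact: measurable_funM].
  by under eq_integral do rewrite -EFinD -mulrDr.
rewrite big_mkord.
apply: (@le_trans _ _
    (\sum_(i < n) A%:E * \int[mu]_x (`|f x| * l i x)%:E)%E).
  by apply: lee_sum => i _; exact: int_h.
rewrite -ge0_sume_distrr; last first.
  by move=> i _; apply: integral_ge0 => x _; rewrite lee_fin mulr_ge0.
rewrite EFinM -muleA lee_wpmul2l ?lee_fin//.
rewrite -ge0_integral_sum//; last 2 first.
- by move=> i; apply/measurable_EFinP; exact: measurable_funM.
- by move=> i x _; rewrite lee_fin mulr_ge0.
rewrite -ge0_integralZl//; last 2 first.
- apply/measurable_EFinP; exact: (measurableT_comp (measurable_powR _)).
- by rewrite lee_fin mulr_ge0 ?powR_ge0.
apply: ge0_le_integral => //.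
- by move=> x _; apply: sume_ge0 => i _; rewrite lee_fin mulr_ge0.
- apply: emeasurable_sum => i; apply/measurable_EFinP; exact: measurable_funM.
- apply: measurable_funeM; apply/measurable_EFinP.
  exact: (measurableT_comp (measurable_powR _)).
move=> x _; rewrite sumEFin -EFinM lee_fin -mulr_sumr.
have fD : 0 <= D * `|f x| by rewrite mulr_ge0// ltW.
apply: (le_trans (ler_wpM2l _ (sum_level_pow_le _ _ _ q0 fD))) => //.
rewrite powRM// ?(ltW D0)// mulrCA -mulrA ler_wpM2l//.
rewrite mulrCA ler_wpM2l ?powR_ge0//.
(* |f| |f|^q = |f|^p also where f = 0, since the exponent 1 + q is nonzero. *)
have := @powRD R `|f x| 1 q; rewrite powRr1// gt_eqF ?(addr_gt0 ltr01 q0)//.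
by move=> /(_ isT) <-; rewrite /q addrC subrK.
Qed.

End interpolation.

(** * Ancestors, nesting and descendants of dyadic intervals *)

Section dyadic_geometry.
Context {R : realType}.
Implicit Types (I J K : dyadic) (x : R).

Lemma dancestor_gen s I : (dancestor s I).1 = I.1 - s%:Z.
Proof. by elim: s => [|s IHs] /=; [rewrite subr0|rewrite IHs; lia]. Qed.

Lemma ditv_dparent I : @ditv R I `<=` ditv (dparent I).
Proof.
have /dparentE := erefl (dparent I).
by rewrite (ditv_children (dparent I)) => -[] <- x ?; [left|right].
Qed.

Lemma ditv_dancestor s I : @ditv R I `<=` ditv (dancestor s I).
Proof. by elim: s => // s IHs x /IHs; exact: ditv_dparent. Qed.

(** Both second indices are the floor of [x * 2 ^ I.1]. *)
Lemma ditv_eq_gen I J x : ditv I x -> ditv J x -> I.1 = J.1 -> I = J.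
Proof.
move=> /ditvE + /ditvE + e; rewrite -e => /andP[h1 h2] /andP[h3 h4].
apply/(injective_projections _ _ e)/eqP; rewrite eq_le -!ltzD1.
by rewrite -!(ltr_int R) (le_lt_trans h1 h4) (le_lt_trans h3 h2).
Qed.

Lemma ditv_nested I J x : ditv I x -> ditv J x -> J.1 <= I.1 ->
  J = dancestor `|I.1 - J.1|%N I.
Proof.
move=> Ix Jx JI; apply: (ditv_eq_gen _ _ x) => //; first exact: ditv_dancestor.
by rewrite dancestor_gen; lia.
Qed.

(** The descent reads the word from its end: the head of [w] is the last step, and [true] means
    right. *)
Definition ddescendant (w : seq bool) K : dyadic :=
  foldr (fun b => if b then dright else dleft) K w.

(** Used for counting: an interval has at most 2^t descendants [t] generations below, one for each
    word. *)
Lemma ddescendant_dancestor t J :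
  exists w : t.-tuple bool, J = ddescendant w (dancestor t J).
Proof.
elim: t J => [|t IHt] J; first by exists (nil_tuple _).
have [w wE] := IHt (dparent J).
have /dparentE := erefl (dparent J).
by case=> Jw; [exists [tuple of false :: w]|exists [tuple of true :: w]];
  rewrite {1}Jw {1}wE /dancestor iterSr.
Qed.

(** An infimum at most [n] leaves some admissible s + t strictly below n + 1, and s + t is a natural
    number. *)
Lemma ddist_le_ancestor I J (n : nat) : (@ddist R I J <= n%:R%:E)%E ->
  exists s t : nat, (s + t <= n)%N /\ dancestor s I = dancestor t J.
Proof.
move=> IJn; have : (@ddist R I J < n.+1%:R%:E)%E.
  by rewrite (le_lt_trans IJn)// lte_fin ltr_nat.
move=> /ereal_inf_lt[_ [s [t [st ->]]]]; rewrite lte_fin ltr_nat => lt_n.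
by exists s, t.
Qed.

Lemma ddist_refl I : (@ddist R I I <= 0)%E.
Proof. by apply: ereal_inf_lbound; exists 0%N, 0%N. Qed.

Lemma measurable_ditv I : measurable (ditv I : set (measurableTypeR R)).
Proof. exact: measurable_itv. Qed.

End dyadic_geometry.

(** * The weak-type bound for the dyadic maximal function *)

Section dyadic_weak_type.
Context {R : realType} (mu : {measure set (measurableTypeR R) -> \bar R}).

(** The condition that the average is at least [lam], cleared of its denominator. *)
Definition heavy (f : R -> \bar R) (lam : R) : set dyadic :=
  [set I | (lam%:E * mu (ditv I) <= \int[mu]_(x in ditv I) f x)%E].

(* The maximal intervals exist once the generations are bounded below; the bound
   is then removed by continuity of the measure from below. *)
Lemma measure_heavy_le (f : R -> \bar R) (lam : R) :
  measurable_fun [set: measurableTypeR R] f -> (forall x, 0 <= f x)%E ->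
  0 < lam ->
  (mu (\bigcup_(I in heavy f lam) ditv I) <= lam^-1%:E * \int[mu]_x f x)%E.
Proof.
move=> mf f0 lam0.
pose hv (n : nat) := [set I | heavy f lam I /\ - n%:Z <= I.1].
pose sel (n : nat) := [set I | hv n I /\
  forall s, (0 < s)%N -> ~ hv n (dancestor s I)].
have mcup P : measurable (\bigcup_(I in P) ditv I : set (measurableTypeR R)).
  by apply: measurable_bigcup_countType => I; exact: measurable_ditv.
have hv_sel n : \bigcup_(I in hv n) @ditv R I `<=` \bigcup_(I in sel n) ditv I.
  move=> x [I hI Ix].
  (* Induction on the height above generation -n: passing to a proper ancestor in [hv n] lowers
     it. *)
  have [m] := ubnP (absz (I.1 + n%:Z)); elim: m I hI Ix => // m IHm I hI Ix Im.
  have [sI|] := pselect (forall s, (0 < s)%N -> ~ hv n (dancestor s I)).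
    by exists I.
  move=> /existsNP[s /not_implyP[s0 /contrapT hs]].
  apply: (IHm (dancestor s I)) => //; first exact: ditv_dancestor.
  by case: hs hI Im => _ + [_ +]; rewrite dancestor_gen; lia.
have sel_disj n : trivIset (sel n) (@ditv R).
  move=> I J [hI sI] [hJ sJ] [x [Ix Jx]].
  wlog JI : I J hI sI hJ sJ Ix Jx / J.1 <= I.1.
    move=> H; have [JI|/ltW IJ] := leP J.1 I.1; first exact: H.
    by apply/esym; apply: (H J I).
  have JE := ditv_nested _ _ _ Ix Jx JI; apply/esym.
  have [s0|s0] := posnP (absz (I.1 - J.1)); first by rewrite JE s0.
  by case: (sI _ s0); rewrite -JE.
have mu_hv n : (mu (\bigcup_(I in hv n) ditv I) <= lam^-1%:E * \int[mu]_x f x)%E.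
  apply: (@le_trans _ _ (mu (\bigcup_(I in sel n) ditv I))).
    by apply: le_measure; rewrite ?inE.
  apply: (measure_bigcup_le_integral mu (sel n) (@ditv R) (@ditv R) f) => //.
  - by move=> I; exact: measurable_ditv.
  - by move=> I; exact: measurable_ditv.
  - by rewrite invr_ge0 ltW.
  - by move=> I [[hI _] _]; rewrite lee_pdivlMl.
have hvE : \bigcup_(I in heavy f lam) @ditv R I =
    \bigcup_n \bigcup_(I in hv n) ditv I.
  apply/seteqP; split => x.
    by move=> [I hI Ix]; exists `|I.1|%N => //; exists I => //; split=> //; lia.
  by move=> [n _ [I [hI _] Ix]]; exists I.
have := @nondecreasing_cvg_mu _ _ _ mu (fun n => \bigcup_(I in hv n) ditv I).
rewrite -hvE => /(_ (fun n => mcup _) (mcup _)) cvg_hv.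
have {}cvg_hv := cvg_hv _.
apply: (cvge_to_le (cvg_hv _)); last exact: nearW.
move=> m n mn; apply/subsetPset => x [I [hI Im] Ix]; exists I => //; split => //.
by lia.
Qed.

End dyadic_weak_type.

(** * Consequences of balancedness for the coefficients *)

Section balanced_coefficients.
Context {R : realType} {mu : {measure set (measurableTypeR R) -> \bar R}}.
Hypothesis hmu : balanced mu.
Implicit Types I J : dyadic.

Lemma dmassE I : mu (ditv I) = (dmass mu I)%:E.
Proof.
by case: hmu => /(_ I)/andP[h1 h2] _ _; rewrite fineK// ge0_fin_numE.
Qed.

Lemma dmass_gt0 I : 0 < dmass mu I.
Proof. by rewrite -lte_fin -dmassE; case: hmu => /(_ I)/andP[]. Qed.

Lemma dmass_children I :
  dmass mu (dleft I) <= dmass mu I /\ dmass mu (dright I) <= dmass mu I.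
Proof.
by split; rewrite -lee_fin -!dmassE; apply: le_measure;
  rewrite ?inE; try exact: measurable_ditv;
  rewrite (ditv_children I) => x ?; [left|right].
Qed.

Lemma dm_gt0 I : 0 < dm mu I.
Proof. by rewrite /dm divr_gt0 ?mulr_gt0 ?dmass_gt0. Qed.

Lemma dm_le_dmass I : dm mu I <= dmass mu I.
Proof.
have [h1 h2] := dmass_children I.
by rewrite /dm ler_pdivrMr ?dmass_gt0// ler_pM// ltW// dmass_gt0.
Qed.

(** Each step up or down the tree costs a factor [c], and at most [n] steps lead from [I] to [J];
    hence D = c^n. *)
Lemma dm_le_ddist (n : nat) : exists2 D : R, 1 <= D &
  forall I J, (@ddist R I J <= n%:R%:E)%E -> dm mu I <= D * dm mu J.
Proof.
case: hmu => _ _ [c c1 hc].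
have c0 : 0 < c by exact: lt_le_trans c1.
have up s I : dm mu (dancestor s I) <= c ^+ s * dm mu I.
  elim: s => [|s IHs]; first by rewrite mul1r.
  have /andP[+ _] := hc (dancestor s I).
  by rewrite mulrC ler_pdivrMr// exprSr -mulrA (mulrC c) => /le_trans; apply;
    rewrite mulrA ler_pM2r.
have down s I : dm mu I <= c ^+ s * dm mu (dancestor s I).
  elim: s => [|s IHs]; first by rewrite mul1r.
  have /andP[_ +] := hc (dancestor s I).
  move=> h; rewrite exprSr -mulrA (le_trans IHs)//.
  by rewrite ler_pM2l ?exprn_gt0.
exists (c ^+ n); first exact: exprn_ege1.
move=> I J /ddist_le_ancestor[s [t [stn st]]].
apply: (le_trans (down s I)); rewrite st.
apply: (@le_trans _ _ (c ^+ (s + t) * dm mu J)).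
  by rewrite exprD -mulrA ler_pM2l ?exprn_gt0.
by rewrite ler_pM2r ?dm_gt0// ler_weXn2l.
Qed.

Lemma ddist_sym I J : @ddist R I J = ddist J I.
Proof.
by congr ereal_inf; apply/seteqP; split => _ [s [t [e ->]]];
  exists t, s; rewrite addnC.
Qed.

(** sqrt(m(I) m(J)) is at most D m(J) <= D mu(J) and, by symmetry of the distance, at most D mu(I).
    The first gives the uniform bound on the coefficient, the second the bound on its product with
    mu(J). *)
Lemma c1b_bounds (n : nat) : exists2 D : R, 1 <= D &
  forall I J, (@ddist R I J <= n%:R%:E)%E ->
    [/\ 0 <= c1b mu I J, c1b mu I J <= D &
        c1b mu I J * dmass mu J <= D * dmass mu I].
Proof.
have [D D1 hD] := dm_le_ddist n.
have D0 : 0 < D by exact: lt_le_trans D1.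
exists D => // I J IJ; rewrite /c1b; case: eqVneq => [->|_].
  by split => //; rewrite ler_pM2r ?dmass_gt0.
have sqrt_le K L : (@ddist R K L <= n%:R%:E)%E ->
    Num.sqrt (dm mu K * dm mu L) <= D * dmass mu L.
  move=> KL; apply: (@le_trans _ _ (D * dm mu L)); last first.
    by rewrite ler_pM2l// dm_le_dmass.
  rewrite -[leRHS]ger0_norm; last by rewrite mulr_ge0// ltW ?dm_gt0.
  rewrite -sqrtr_sqr ler_wsqrtr// expr2.
  apply: ler_pM; rewrite ?(ltW (dm_gt0 _))//; first exact: hD.
  by rewrite ler_peMl// ltW ?dm_gt0.
split.
- by rewrite divr_ge0 ?sqrtr_ge0// ltW ?dmass_gt0.
- by rewrite ler_pdivrMr ?dmass_gt0// sqrt_le.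
- by rewrite divfK ?gt_eqF ?dmass_gt0// mulrC sqrt_le// ddist_sym.
Qed.

End balanced_coefficients.

(** * Level sets and measurability of the maximal operator *)

Section dyadic_maximal_operator.
Context {R : realType} {mu : {measure set (measurableTypeR R) -> \bar R}}.
Hypothesis hmu : balanced mu.
Implicit Types (I J : dyadic) (f : R -> R) (lam : R).

Local Notation absf f := (fun y : R => `|f y|%:E).

Lemma daverage_ge0 f I : (0 <= daverage mu (absf f) I)%E.
Proof.
rewrite mule_ge0//; first by rewrite lee_fin invr_ge0 ltW// dmass_gt0.
by apply: integral_ge0 => y _; rewrite lee_fin.
Qed.

Lemma ddist_refl_le N I : (@ddist R I I <= (N + 2)%N%:R%:E)%E.
Proof. by rewrite (le_trans (ddist_refl I)). Qed.

Lemma ditv_cover (x : R) : exists I, ditv I x.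
Proof.
exists (0, Num.floor x); apply/ditvE; rewrite /= expr0z mulr1.
by rewrite floor_le floorD1_gt.
Qed.

Lemma dmaximal_ge N f I J x : (@ddist R I J <= (N + 2)%N%:R%:E)%E ->
  ditv J x -> ((c1b mu I J)%:E * daverage mu (absf f) I <= dmaximal mu N f x)%E.
Proof.
move=> IJ Jx; apply: ereal_sup_ubound; exists I, J; split => //.
by rewrite indicE mem_set// mule1.
Qed.

Lemma dmaximal_ge0 N f x : (0 <= dmaximal mu N f x)%E.
Proof.
have [I Ix] := ditv_cover x.
apply: le_trans (dmaximal_ge _ _ _ _ _ (ddist_refl_le N I) Ix).
by rewrite /c1b eqxx mul1e daverage_ge0.
Qed.

(** A nonnegative [lam] excludes the pairs with [x] outside [J], whose value is 0. *)
Lemma dmaximal_gtP N f lam x : 0 <= lam ->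
  (lam%:E < dmaximal mu N f x)%E <->
  exists I J, [/\ (@ddist R I J <= (N + 2)%N%:R%:E)%E,
    (lam%:E < (c1b mu I J)%:E * daverage mu (absf f) I)%E & ditv J x].
Proof.
move=> lam0; split=> [|[I [J [IJ h Jx]]]]; last first.
  exact: lt_le_trans h (dmaximal_ge _ _ _ _ _ IJ Jx).
move=> /ereal_sup_gt[_ [I [J [IJ ->]]]]; rewrite indicE.
have [Jx|_] := boolP (x \in _); last by rewrite mule0 lte_fin ltNge lam0.
by rewrite mule1 => h; exists I, J; split => //; rewrite inE in Jx.
Qed.

(** For lam >= 0 the level set is a union of intervals [J] over a countable set of pairs of indices;
    for lam < 0 it is the whole line. *)
Lemma measurable_dmaximal_gt N f lam :
  measurable ([set x | (lam%:E < dmaximal mu N f x)%E] :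
    set (measurableTypeR R)).
Proof.
have [lam0|lam0] := ltP lam 0.
  rewrite [X in measurable X](_ : _ = setT)//.
  apply/seteqP; split => // x _.
  by apply: lt_le_trans (dmaximal_ge0 _ _ _); rewrite lte_fin.
rewrite [X in measurable X](_ : _ = \bigcup_(IJ in
    [set IJ : dyadic * dyadic | (@ddist R IJ.1 IJ.2 <= (N + 2)%N%:R%:E)%E /\
     (lam%:E < (c1b mu IJ.1 IJ.2)%:E * daverage mu (absf f) IJ.1)%E])
    ditv IJ.2).
  apply: measurable_bigcup_countType => IJ; exact: measurable_ditv.
apply/seteqP; split => x.
  by move=> /(dmaximal_gtP _ _ _ _ lam0)[I [J [h1 h2 h3]]]; exists (I, J).
by move=> [[I J] [/= h1 h2] h3]; apply/(dmaximal_gtP _ _ _ _ lam0); exists I, J.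
Qed.

Lemma measurable_dmaximal N f :
  measurable_fun [set: measurableTypeR R] (dmaximal mu N f).
Proof.
apply: (measurability _ (ErealGenOInfty.measurableE R)) => _ [_ [lam ->] <-].
rewrite setTI (_ : _ @^-1` _ = [set x | (lam%:E < dmaximal mu N f x)%E]).
  exact: measurable_dmaximal_gt.
by apply/seteqP; split => x /=; rewrite in_itv /= andbT.
Qed.

Lemma daverageD f (a : R) I :
  measurable_fun [set: measurableTypeR R] f -> 0 <= a ->
  (daverage mu (fun y => `|f y|%:E + a%:E) I = daverage mu (absf f) I + a%:E)%E.
Proof.
move=> mf a0; rewrite /daverage ge0_integralD//=; last 2 first.
- exact: measurable_ditv.
- apply/measurable_EFinP; apply: measurableT_comp => //.
  exact: measurable_funTS.
rewrite integral_cst; last exact: measurable_ditv.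
rewrite ge0_muleDr//; last 2 first.
- by apply: integral_ge0.
- by rewrite mule_ge0.
by rewrite (dmassE hmu) -!EFinM mulrCA mulVf ?mulr1 ?gt_eqF ?(dmass_gt0 hmu).
Qed.

Lemma le_daverage (g h : R -> \bar R) I :
  measurable_fun [set: measurableTypeR R] g ->
  measurable_fun [set: measurableTypeR R] h ->
  (forall y, 0 <= g y <= h y)%E ->
  (daverage mu g I <= daverage mu h I)%E.
Proof.
move=> mg mh gh; rewrite lee_pmul2l ?lte_fin ?invr_gt0 ?(dmass_gt0 hmu)//.
apply: ge0_le_integral; first exact: measurable_ditv.
- by move=> y _; have /andP[] := gh y.
- exact: measurable_funTS.
- exact: measurable_funTS.
- by move=> y _; have /andP[] := gh y.
Qed.

End dyadic_maximal_operator.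

(** * The weak-type estimate for the maximal operator *)

Section weak_type.
Context {R : realType} {mu : {measure set (measurableTypeR R) -> \bar R}}.
Hypothesis hmu : balanced mu.
Implicit Types (I J : dyadic) (f : R -> R) (lam : R).
Local Notation absf f := (fun y : R => `|f y|%:E).

(** Applied with a = c_1^b(I, J) twice: K = I shows that [I] is heavy at height lam / D, and K = J
    bounds mu(J) by the integral over [I]. *)
Lemma heavy_of_large_coefficient f I K (D a lam : R) :
  0 < D -> 0 < lam -> 0 <= a ->
  a * dmass mu K <= D * dmass mu I ->
  (lam%:E < a%:E * daverage mu (absf f) I)%E ->
  ((lam / D)%:E * mu (ditv K) <= \int[mu]_(y in ditv I) (absf f) y)%E.
Proof.
move=> D0 lam0 a0 aKI; rewrite /daverage (dmassE hmu).
have : (0 <= \int[mu]_(y in ditv I) (absf f) y)%E by exact: integral_ge0.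
case: (integral _ _ _) => [r||]; last 2 first.
- by move=> _ _; rewrite leey.
- by rewrite leNgt ltNyr.
rewrite lee_fin => r0; rewrite -!EFinM lte_fin lee_fin => h.
have mI := dmass_gt0 hmu I; have mK := dmass_gt0 hmu K.
have {}h : lam * dmass mu I <= a * r.
  by move: h; rewrite mulrCA mulrC ltr_pdivlMr// => /ltW.
rewrite mulrAC ler_pdivrMr// -(ler_pM2r mI).
apply: (@le_trans _ _ (a * r * dmass mu K)).
  by rewrite mulrAC ler_wpM2r// ltW.
rewrite mulrAC (le_trans (ler_wpM2r r0 aKI))// mulrAC -mulrA mulrCA mulrA.
by rewrite lexx.
Qed.

Lemma dmaximal_weak_type (N : nat) : exists2 A : R, 0 <= A &
  forall f lam, measurable_fun [set: measurableTypeR R] f -> 0 < lam ->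
  (mu [set x | (lam%:E < dmaximal mu N f x)%E] <=
     (A / lam)%:E * \int[mu]_x (absf f) x)%E.
Proof.
have [D D1 hD] := c1b_bounds hmu (N + 2)%N.
have D0 : 0 < D by exact: lt_le_trans D1.
pose n := (N + 3)%N.
(* An index (s, word, r) sends I to the J reached by going up s generations
   and then down along the word; r is the residue of the generation of I. *)
pose idx := ('I_n * {t : 'I_n & t.-tuple bool} * 'I_n)%type.
exists (#|{: option idx}|%:R * D); first by rewrite mulr_ge0// ltW.
move=> f lam mf lam0.
pose g := absf f; pose k := lam / D.
have k0 : 0 < k by rewrite divr_gt0.
have mg : measurable_fun [set: measurableTypeR R] g.
  by apply/measurable_EFinP; apply: measurableT_comp.
have g0 x : (0 <= g x)%E by rewrite lee_fin.
pose Om := \bigcup_(I in heavy mu g k) @ditv R I.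
pose desc (i : idx) I := ddescendant (tagged i.1.2) (dancestor i.1.1 I).
(* The intervals [I] whose ancestor shared with [J] leaves [Om]; fixing [s] and the residue makes
   them pairwise disjoint. *)
pose bad (i : idx) := [set I | [/\ heavy mu g k I,
  ~ ditv (dancestor i.1.1 I) `<=` Om, (I.1 %% n%:Z)%Z = (i.2 : nat)%:Z :> int &
  (k%:E * mu (ditv (desc i I)) <= \int[mu]_(y in ditv I) g y)%E]].
(* The extra index [None] carries [Om]. Each of these sets has measure at most (D / lam) int |f|,
   which explains the constant. *)
pose A (i : option idx) : set (measurableTypeR R) :=
  if i is Some j then \bigcup_(I in bad j) ditv (desc j I) else Om.
have mditv I : measurable (ditv I : set (measurableTypeR R)).
  exact: measurable_ditv.
have bad_disj i : trivIset (bad i) (@ditv R).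
  move=> I J [hI sI rI _] [hJ sJ rJ _] [x [Ix Jx]].
  wlog JI : I J hI sI rI hJ sJ rJ Ix Jx / J.1 <= I.1.
    move=> H; have [JI|/ltW IJ] := leP J.1 I.1; first exact: H.
    by apply/esym; apply: (H J I).
  have JE := ditv_nested _ _ _ Ix Jx JI; apply/esym.
  have [s0|s0] := posnP (absz (I.1 - J.1)); first by rewrite JE s0.
  (* Distinct generations congruent modulo [n] differ by at least n > s, so [J] contains I^(s); but
     [J] is heavy, hence inside [Om], a contradiction. *)
  have ns : (i.1.1 <= absz (I.1 - J.1))%N.
    have := ltn_ord i.1.1; have : (n%:Z %| (I.1 - J.1))%Z.
      by rewrite -eqz_mod_dvd rI rJ.
    by move=> /dvdn_leq => /(_ s0); lia.
  case: sI => y Iy; exists J => //; rewrite JE -(subnK ns).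
  by rewrite /dancestor iterD; exact: ditv_dancestor.
have mA i : measurable (A i).
  by case: i => [i|]; exact: measurable_bigcup_countType.
have muA i : (mu (A i) <= (k^-1)%:E * \int[mu]_x g x)%E.
  case: i => [i|]; last exact: measure_heavy_le.
  apply: (measure_bigcup_le_integral mu (bad i) (@ditv R)
    (fun I => ditv (desc i I)) g) => //.
    by rewrite invr_ge0 ltW.
  by move=> I [_ _ _ hI]; rewrite lee_pdivlMl.
rewrite -mulrA -[D / lam]invf_div.
apply: le_trans (measure_bigcup_finType_le mu _ _ _ _ mA muA _); last first.
  by rewrite invr_ge0 ltW.
apply: le_measure; rewrite ?inE.
- exact: measurable_dmaximal_gt.
- exact: measurable_bigcup_countType.
move=> x /(dmaximal_gtP _ _ _ _ (ltW lam0))[I [J [IJ lamIJ Jx]]].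
have [c0 cD cJ] := hD _ _ IJ.
have hI : heavy mu g k I.
  apply: (heavy_of_large_coefficient _ _ _ _ (c1b mu I J)) => //.
  by rewrite ler_pM2r// (dmass_gt0 hmu).
have [s [t [stn st]]] := ddist_le_ancestor _ _ _ IJ.
(* I^(s) = J^(t) contains [J], so in the first case [x] lies in [Om]. *)
have [JOm|JOm] := pselect (ditv (dancestor s I) `<=` Om).
  exists None => //; apply: JOm; rewrite st; exact: ditv_dancestor Jx.
have [w Jw] := ddescendant_dancestor t J.
have sn : (s < n)%N by lia.
have tn : (t < n)%N by lia.
have rn : (absz (I.1 %% n%:Z)%Z < n)%N.
  have n0 : 0 < n%:Z by lia.
  by have := ltz_pmod I.1 n0; have := modz_ge0 I.1 (lt0r_neq0 n0); lia.
pose i : idx := (Ordinal sn,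
  Tagged (fun t : 'I_n => t.-tuple bool) (w : (Ordinal tn).-tuple bool),
  Ordinal rn).
have JE : desc i I = J by rewrite /desc /= st.
exists (Some i) => //; exists I; last by rewrite JE.
split => //=; first by rewrite gez0_abs// modz_ge0//; lia.
by rewrite JE; exact: (heavy_of_large_coefficient _ _ _ _ (c1b mu I J)).
Qed.

End weak_type.

(** * Truncation and the strong bounds for 1 < p <= oo *)

Section strong_type.
Context {R : realType} {mu : {measure set (measurableTypeR R) -> \bar R}}.
Hypothesis hmu : balanced mu.
Local Notation absf f := (fun y : R => `|f y|%:E).

Definition trunc_below (a : R) (f : R -> R) (y : R) : R :=
  f y * (a < `|f y|)%R%:R.

Lemma measurable_trunc_below (a : R) (f : R -> R) :
  measurable_fun [set: measurableTypeR R] f ->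
  measurable_fun [set: measurableTypeR R] (trunc_below a f).
Proof.
move=> mf; apply: measurable_funM => //.
have mnf : measurable_fun [set: measurableTypeR R] (fun x => `|f x|).
  exact: measurableT_comp.
rewrite [X in measurable_fun _ X](_ : _ = \1_[set y | a < `|f y|]).
  apply: measurable_indic; rewrite -[X in measurable X]setTI.
  exact: measurable_fun_ltr.
by apply/funext => x; rewrite indicE; congr (nat_of_bool _)%:R;
  apply/idP/idP; rewrite inE.
Qed.

(** Pointwise |f| is at most its truncation plus [a], and the constant [a] contributes at most D a
    because the coefficients are at most [D]. *)
Lemma dmaximal_le_trunc N (D a : R) (f : R -> R) (x : R) :
  measurable_fun [set: measurableTypeR R] f -> 0 <= a ->
  (forall I J, (@ddist R I J <= (N + 2)%N%:R%:E)%E -> 0 <= c1b mu I J <= D) ->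
  (dmaximal mu N f x <= dmaximal mu N (trunc_below a f) x + (D * a)%:E)%E.
Proof.
move=> mf a0 hD.
have mabs (h : R -> R) : measurable_fun [set: measurableTypeR R] h ->
    measurable_fun [set: measurableTypeR R] (absf h).
  by move=> mh; apply/measurable_EFinP; apply: measurableT_comp.
apply: ge_ereal_sup => _ [I [J [IJ ->]]]; rewrite indicE.
have /andP[c0 cD] := hD _ _ IJ.
have D0 : 0 <= D by exact: le_trans cD.
have [Jx|_] := boolP (x \in _); last first.
  by rewrite mule0 adde_ge0 ?(dmaximal_ge0 hmu)// lee_fin mulr_ge0.
rewrite inE in Jx; rewrite mule1.
have /(lee_wpmul2l (c0 : (0 <= (c1b mu I J)%:E)%E)) : (daverage mu (absf f) I <=
    daverage mu (absf (trunc_below a f)) I + a%:E)%E.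
  rewrite -(daverageD hmu)//; last exact: measurable_trunc_below.
  apply: (le_daverage hmu); first exact: mabs.
    by apply: emeasurable_funD => //; apply: mabs; exact: measurable_trunc_below.
  move=> y; rewrite !lee_fin normr_ge0 /trunc_below.
  by case: ltP => h; rewrite ?mulr1 ?mulr0 ?normr0 ?add0r// lerDl.
move=> /le_trans; apply; rewrite ge0_muleDr ?(daverage_ge0 hmu)//.
by rewrite leeD ?(dmaximal_ge _ _ _ _ _ IJ Jx)// lee_fin ler_wpM2r.
Qed.

(** Truncating at a = lam / (2 D) makes the discarded part contribute at most lam / 2, so the
    weak-type bound is applied to the truncation at level lam / 2. This doubles both constants. *)
Lemma dmaximal_level_bound (N : nat) : exists A D : R,
  [/\ 0 <= A, 0 < D & forall (f : R -> R) (lam : R),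
  measurable_fun [set: measurableTypeR R] f -> 0 < lam ->
  (mu [set x | (lam%:E < dmaximal mu N f x)%E] <=
   (A / lam)%:E * \int[mu]_x (`|f x| * (lam < D * `|f x|)%R%:R)%:E)%E].
Proof.
have [D D1 hD] := c1b_bounds hmu (N + 2)%N.
have D0 : 0 < D by exact: lt_le_trans D1.
have [A A0 weak] := dmaximal_weak_type hmu N.
exists (A * 2), (2 * D); split; rewrite ?mulr_ge0 ?mulr_gt0//.
move=> f lam mf lam0; pose a := lam / (2 * D).
have a0 : 0 < a by rewrite divr_gt0// mulr_gt0.
have mt := measurable_trunc_below a f mf.
have l2 : 0 < lam / 2 by rewrite divr_gt0.
have -> : A * 2 / lam = A / (lam / 2) by rewrite invf_div mulrA.
have -> : (\int[mu]_x (`|f x| * (lam < 2 * D * `|f x|)%R%:R)%:E =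
    \int[mu]_x `|trunc_below a f x|%:E)%E.
  apply: eq_integral => x _; rewrite normrM; congr (_ * _)%:E.
  by rewrite /a ltr_pdivrMr ?mulr_gt0// mulrC; case: ltP;
    rewrite ?normr1 ?normr0.
apply: le_trans (weak _ _ mt l2); apply: le_measure; rewrite ?inE.
- exact: measurable_dmaximal_gt.
- exact: measurable_dmaximal_gt.
move=> x /= /lt_le_trans /(_ (dmaximal_le_trunc N D a f x mf (ltW a0) _)).
have Da : D * a = lam / 2.
  by rewrite /a invfM mulrCA (mulrCA D) divff ?gt_eqF// mulr1.
have DI I J : (@ddist R I J <= (N + 2)%N%:R%:E)%E -> 0 <= c1b mu I J <= D.
  by move=> /hD[-> ->].
move=> /(_ DI); rewrite Da -lteBlDr// -EFinB.
by congr (_ < _)%E; congr EFin; lra.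
Qed.

Lemma dmaximal_bounded_Lfin (N : nat) (p : R) : 1 < p ->
  bounded_Lp mu p%:E (dmaximal mu N).
Proof.
move=> p1; have p0 : 0 < p by exact: lt_trans p1.
have [A [D [A0 D0 hAD]]] := dmaximal_level_bound N.
have [C C0 hC] := marcinkiewicz_level_bound mu p A D p1 A0 D0.
exists (C `^ p^-1); first exact: powR_ge0.
move=> f /sub_Lfun_mfun; rewrite inE => /= mf.
have mM := measurable_dmaximal hmu N f.
split => //.
have := hC _ _ mf mM (dmaximal_ge0 hmu N f) (fun lam => hAD f lam mf).
rewrite unlock => h.
rewrite -poweR_EFin -poweRM ?lee_fin//; last first.
  by apply: integral_ge0 => x _; rewrite poweR_ge0.
have pV0 : 0 <= p^-1 by rewrite invr_ge0 ltW.
apply: gt0_ler_poweR => //.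
- by rewrite in_itv /= leey andbT; apply: integral_ge0 => x _; exact: poweR_ge0.
- rewrite in_itv /= leey andbT mule_ge0 ?lee_fin//.
  by apply: integral_ge0 => x _; rewrite lee_fin powR_ge0.
by under eq_integral do rewrite gee0_abs ?(dmaximal_ge0 hmu)//.
Qed.

Lemma dmaximal_bounded_Linfty (N : nat) : bounded_Lp mu +oo (dmaximal mu N).
Proof.
have [D D1 hD] := c1b_bounds hmu (N + 2)%N.
have D0 : 0 < D by exact: lt_le_trans D1.
exists D; first exact: ltW.
move=> f /sub_Lfun_mfun; rewrite inE => /= mf.
split; first exact: (measurable_dmaximal hmu).
(* The L^oo norm is the essential supremum only when the total mass is positive, so this selects the
   right branch. *)
have muT : (0 < mu [set: measurableTypeR R])%E.
  have [/(_ (0, 0))/andP[mu0 _] _ _] := hmu.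
  apply: (lt_le_trans mu0); apply: le_measure; rewrite ?inE//.
  exact: measurable_ditv.
rewrite unlock muT; set M := (X in (_ <= D%:E * X)%E).
have fM : \forall x \ae mu, (`|f x|%:E <= M)%E by exact: (ess_sup_ge mu (absf f)).
have M0 : (0 <= M)%E.
  by apply: ess_sup_gee => //; apply: nearW => x /=; rewrite lee_fin.
(* If the norm of [f] is +oo, so is the right side, because D > 0. *)
case: M M0 fM => [r| |]// r0 fr; last by rewrite gt0_muley ?lte_fin// leey.
apply/ess_supP; apply: nearW => x /=; rewrite gee0_abs ?(dmaximal_ge0 hmu)//.
apply: ge_ereal_sup => _ [I [J [IJ ->]]]; rewrite indicE.
have [c0 cD _] := hD _ _ IJ.
case: (x \in _); last by rewrite mule0 mule_ge0 ?lee_fin// ltW.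
rewrite mule1; apply: lee_pmul; rewrite ?lee_fin ?(daverage_ge0 hmu)//.
have mI := measurable_ditv I.
rewrite /daverage lee_pdivrMl ?(dmass_gt0 hmu)// muleC -(dmassE hmu).
rewrite -integral_cst//; apply: ae_ge0_le_integral => //.
- by apply/measurable_EFinP; apply: measurableT_comp => //; exact: measurable_funTS.
- by move: fr; apply: filterS => y h _.
Qed.

End strong_type.

(** * The endpoint p = 1 and the conclusion *)

Lemma dmaximal_weak_type11 {R : realType}
    {mu : {measure set (measurableTypeR R) -> \bar R}} (hmu : balanced mu)
    (N : nat) : weak_type11 mu (dmaximal mu N).
Proof.
have [A A0 weak] := dmaximal_weak_type hmu N.
exists A => // f /sub_Lfun_mfun; rewrite inE => /= mf.
split; first exact: (measurable_dmaximal hmu).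
rewrite Lnorm1; apply: ge_ereal_sup => _ [t /= t0 <-].
under eq_set do rewrite gee0_abs ?(dmaximal_ge0 hmu)//.
by rewrite -lee_pdivlMl// muleA -EFinM (mulrC _ A); exact: weak.
Qed.

Theorem lemma2p8 (R : realType)
    (mu : {measure set (measurableTypeR R) -> \bar R}) (N : nat)
    (hmu : balanced mu) :
  (forall p : \bar R, (1 < p)%E -> bounded_Lp mu p (dmaximal mu N)) /\
  weak_type11 mu (dmaximal mu N).
Proof.
split; last exact: dmaximal_weak_type11.
case=> [p| |]//; last by move=> _; exact: dmaximal_bounded_Linfty.
by rewrite lte_fin => p1; exact: dmaximal_bounded_Lfin.
Qed.
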